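(* Let $X$ be an infinite regular cardinal, $n\geq 1$, and $N=\{1,\ldots,n\}$. A function $f\in\mathcal O^{(n)}$ is an element of $\mathrm{Pol}(T_1)$ if and only if all pairs of $f$-wild subsets of $N$ have a nonempty intersection.
   Context: $\mathcal O^{(n)}$ is the set of all functions $X^n\to X$, $\mathcal O=\bigcup_{n\geq 1}\mathcal O^{(n)}$. A function $f\in\mathcal O^{(n)}$ is almost unary if there exist $F\in\mathcal O^{(1)}$ and $1\leq k\leq n$ such that $f(x_1,\ldots,x_n)<F(x_k)$ for all $(x_1,\ldots,x_n)\in X^n$ (here $<$ is the well-order of the cardinal $X$). $T_1$ is the set of all binary almost unary functions. $\mathrm{Pol}(T_1)$ is the set of all $f\in\mathcal O$, say of arity $n$, such that $f(g_1,\ldots,g_n)\in T_1$ for all $g_1,\ldots,g_n\in T_1$. A subset of $X$ is large if its cardinality is $|X|$ (equivalently, it is unbounded in $X$). The set $X^n$ is identified with the set of functions $N\to X$, and $-A=N\setminus A$ for $A\subseteq N$; so for $a\in X^{-A}$ and $x\in X^A$, $a\cup x\in X^n$. For $f\in\mathcal O^{(n)}$, a set $A\subsetneq N$ is $f$-wild if there exists $a\in X^{-A}$ such that $\{f(a\cup x):x\in X^A\}$ is large. The set $N$ itself is $f$-wild iff $f$ is unbounded (has large range). *)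

(* Defs.v *)
From mathcomp Require Export all_boot all_order.
From mathcomp Require Export boolp classical_sets functions cardinality.
From mathcomp Require wochoice.

Set Implicit Arguments.
Unset Strict Implicit.
Unset Printing Implicit Defensive.

Import Order.TTheory.
Local Open Scope classical_set_scope.
Local Open Scope card_scope.

(* An infinite regular cardinal is an infinite initial ordinal all of whose
   cofinal subsets have full cardinality (i.e. it equals its own cofinality).
   As ordinals are determined by their order type, the cardinal is represented,
   up to order isomorphism, by an ordered type X. *)
Definition infinite_regular_cardinal (d : Order.disp_t) (X : orderType d) : Prop :=
  [/\ wochoice.well_order (<=%O : rel X),
      infinite_set [set: X],
      (forall x : X, ~ ([set: X] #<= [set y : X | (y < x)%O])) &
      (forall A : set X,
         (forall x : X, exists2 y : X, A y & (x <= y)%O) -> A #= [set: X])].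

Definition large (X : Type) (A : set X) : Prop := A #= [set: X].

(* O^(n); the indices 1, ..., n are 0, ..., n - 1 here. *)
Definition operation (X : Type) (n : nat) : Type := ('I_n -> X) -> X.

Definition almost_unary (d : Order.disp_t) (X : orderType d) (n : nat)
    (f : operation X n) : Prop :=
  exists (F : X -> X) (k : 'I_n), forall x : 'I_n -> X, (f x < F (x k))%O.

Definition T1 (d : Order.disp_t) (X : orderType d) : set (operation X 2) :=
  [set g | almost_unary g].
Arguments T1 {d} X.

Definition Pol (X : Type) (m : nat) (C : set (operation X m)) (n : nat) :
    set (operation X n) :=
  [set f | forall g : 'I_n -> operation X m,
     (forall i, C (g i)) -> C (fun x => f (fun i => g i x))].
Arguments Pol {X m} C n.

(* The function a \cup x, that is, the element of X^n that is a outside A and x on A. *)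
Definition glue (X : Type) (n : nat) (A : {set 'I_n})
    (a : {i : 'I_n | i \notin A} -> X) (x : {i : 'I_n | i \in A} -> X) :
    'I_n -> X :=
  fun i => match decP (@idP (i \in A)) with
           | left iA => x (exist _ i iA)
           | right iNA => a (exist _ i (introN idP iNA))
           end.

Definition wild (X : Type) (n : nat) (f : operation X n) (A : {set 'I_n}) : Prop :=
  if A == [set: 'I_n]%SET then large (range f)
  else exists a : {i : 'I_n | i \notin A} -> X,
         large (range (fun x : {i : 'I_n | i \in A} -> X => f (glue a x))).

(* Main.v *)
Require Import Defs.

Set Implicit Arguments.
Unset Strict Implicit.
Unset Printing Implicit Defensive.

Import Order.TTheory.
Local Open Scope classical_set_scope.
Local Open Scope card_scope.

(** Largeness is replaced throughout by unboundedness, and wildness of [A] by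
    a condition on total tuples: some tuple [a] can be modified on [A] so as to
    make [f] exceed any given value ([wildP], which treats the full index set
    uniformly with the proper subsets).

    If two disjoint sets [A] and [B] are wild, witnessed by [a] and [b], take
    two variables and let the tuple of the inner functions move along the
    [A]-witnesses as the second variable grows while the first is at a base
    point [o], and along the [B]-witnesses as the first one grows while the
    second is at [o].  Since [A] and [B] are disjoint, each coordinate of
    this tuple follows only one of the two variables, so the inner functions
    are almost unary; but the composite is unbounded on both axes through
    [o], hence bounded by a function of neither variable ([wild_meet_of_Pol]).

    Conversely, almost unary inner functions [g i] split the indices according
    to the variable that controls them, and one of the two disjoint classes is
    not wild.  When the variable controlling the other class is fixed, the
    coordinates in that other class stay in a box of bounded sides.  For each
    point of the box [f] is bounded whatever the remaining coordinates are, and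
    regularity makes these bounds uniform over the box ([bounded_on_box]), so
    the composite is bounded by a function of that variable. *)

Section RegularCardinal.

Variables (d : Order.disp_t) (X : orderType d).
Hypothesis hX : infinite_regular_cardinal X.

Lemma exists_above (x : X) : exists y, (x < y)%O.
Proof.
case: hX => _ Xinf _ Xreg; apply: contrapT => xmax.
(* A maximum would form a cofinal singleton, of the same size as [X]. *)
have /Xreg /eq_finite_set fin : forall y : X, exists2 z, [set x] z & (y <= z)%O.
  by move=> y; exists x => //; rewrite leNgt; apply/negP => xy; apply: xmax; exists y.
by apply: Xinf; rewrite -fin; exact: finite_set1.
Qed.

Lemma inhabited_carrier : exists x : X, True.
Proof.
case: hX => _ Xinf _ _; apply: contrapT => X0; apply: Xinf.
suff -> : [set: X] = set0 by exact: finite_set0.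
by rewrite -subset0 => x _; apply: X0; exists x.
Qed.

Lemma largeP (S : set X) :
  large S <-> forall x : X, exists2 y, S y & (x <= y)%O.
Proof.
case: hX => _ _ Xinit Xreg; split=> [SX x|]; last exact: Xreg.
apply: contrapT => Sx; apply: (Xinit x).
rewrite -(card_le_eql SX); apply: subset_card_le => y Sy /=.
by rewrite ltNge; apply/negP => xy; apply: Sx; exists y.
Qed.

(** An unbounded image of a proper initial segment would have the size of [X]
    by regularity, which is more than the size of the segment. *)
Lemma bounded_on_segment (h : X -> X) (c : X) :
  exists M, forall y, (y < c)%O -> (h y < M)%O.
Proof.
case: hX => _ _ Xinit Xreg; apply: contrapT => unbd; apply: (Xinit c).
have imX : h @` [set y | (y < c)%O] #= [set: X].
  apply: Xreg => M; apply: contrapT => hM; apply: unbd; exists M => y yc.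
  by rewrite ltNge; apply/negP => My; apply: hM; exists (h y) => //; exists y.
by rewrite -(card_le_eql imX); exact: card_image_le.
Qed.

(** Letting the free coordinates vary one at a time, each new one over an
    initial segment, avoids any estimate of the number of points of a box. *)
Lemma bounded_on_box (n : nat) (h : ('I_n -> X) -> X) (c : 'I_n -> X)
    (s : seq 'I_n) (a : 'I_n -> X) :
  exists M, forall x : 'I_n -> X,
    (forall i, i \notin s -> x i = a i) -> (forall i, i \in s -> (x i < c i)%O) ->
    (h x < M)%O.
Proof.
elim: s a => [|i s IHs] a.
  have [M aM] := exists_above (h a); exists M => x xa _.
  by suff -> : x = a by []; apply/funext => j; exact: xa.
have [m hm] := choice (fun y => IHs [eta a with i |-> y]).
have [M mM] := bounded_on_segment m (c i).
exists M => x xa xc; apply: lt_trans (mM (x i) (xc i (mem_head i s))).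
apply: hm => j js; last by apply: xc; rewrite inE js orbT.
by rewrite /=; case: eqVneq => [->//|ji]; apply: xa; rewrite inE negb_or ji.
Qed.

(** Total tuples agreeing outside [A] stand for the tuples glued from a fixed
    part outside [A] and a varying part on [A]. *)
Lemma wildP (n : nat) (f : operation X n) (A : {set 'I_n}) :
  wild f A <-> exists a : 'I_n -> X, forall y : X, exists x : 'I_n -> X,
    (forall i, i \notin A -> x i = a i) /\ (y <= f x)%O.
Proof.
have [o _] := inhabited_carrier.
rewrite /wild; case: eqVneq => [->|_].
  split=> [/largeP fub|[a fub]].
    exists (fun=> o) => y; have [_ [x _ <-] yx] := fub y.
    by exists x; split=> // i; rewrite inE.
  by apply/largeP => y; have [x [_ yx]] := fub y; exists (f x) => //; exists x.
split=> [[a /largeP fub]|[a fub]].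
  exists (glue a (fun=> o)) => y; have [_ [x _ <-] yx] := fub y.
  exists (glue a x); split=> // i iA; rewrite /glue.
  by case: decP => // iA'; rewrite iA' in iA.
exists (fun i => a (val i)); apply/largeP => y; have [x [xa yx]] := fub y.
exists (f x) => //; exists (fun i => x (val i)) => //; congr f.
apply/funext => i; rewrite /glue; case: decP => //= iA.
by rewrite xa //; exact/negP.
Qed.

(** The inner functions [g i] move the tuple along the wildness witnesses of [A]
    on one axis and along those of [B] on the other one. *)
Lemma wild_meet_of_Pol (n : nat) (f : operation X n) (A B : {set 'I_n}) :
  Pol (T1 X) n f -> wild f A -> wild f B -> (A :&: B)%SET != finset.set0.
Proof.
move=> fPol /wildP [a fa] /wildP [b fb]; apply/negP => /eqP AB0.
have [o _] := inhabited_carrier.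
have [u ufa] := choice fa; have [v vfb] := choice fb.
have ua y i : i \notin A -> u y i = a i by case: (ufa y) => + _; apply.
have vb y i : i \notin B -> v y i = b i by case: (vfb y) => + _; apply.
pose g (i : 'I_n) : operation X 2 := fun x =>
  if x ord0 == o then u (x ord_max) i else
  if x ord_max == o then v (x ord0) i else o.
have gT1 i : T1 X (g i).
  have [up hup] := choice exists_above.
  (* Strictly above the three possible values of the coordinate [i]. *)
  pose F (w : X -> 'I_n -> X) (e : 'I_n -> X) y :=
    up (Order.max (w y i) (Order.max (e i) o)).
  have FP w e y : [/\ w y i < F w e y, e i < F w e y & o < F w e y]%O.
    by have := hup (Order.max (w y i) (Order.max (e i) o));
      rewrite !gt_max => /and3P.
  have [iA|iA] := boolP (i \in A).
    have iB : i \notin B.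
      by apply/negP => iB; have := finset.in_set0 i; rewrite -AB0 inE iA iB.
    exists (F u b), ord_max => x; rewrite /g; have [? ? ?] := FP u b (x ord_max).
    by do 2?case: eqP => // _; rewrite vb.
  exists (F v a), ord0 => x; rewrite /g; have [? ? ?] := FP v a (x ord0).
  by do 2?case: eqP => // _; rewrite ua.
have [F [k fF]] := fPol g gT1.
have [z oz] := exists_above o.
(* With the variable [k] at [o] the composite would stay below [F o], but with
   the other variable at [y] it is at least [y >= F o].  The condition [o < y]
   is for the axis of [v]: at the common point of the axes the tuple follows
   [u] only. *)
pose y := Order.max (F o) z.
have yo : (y == o) = false by rewrite gt_eqF // /y lt_max oz orbT.
have Foy : (F o <= y)%O by rewrite /y le_max lexx.
have := fF (fun i => if i == k then o else y); rewrite eqxx.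
move=> /lt_le_trans /(_ Foy); rewrite ltNge => /negP; apply.
have [k0|k1] := eqVneq k ord0.
  by rewrite k0 /g /= eqxx; case: (ufa y).
have -> : k = ord_max by apply/val_inj; case: k k1 {fF} => [[|[|]]].
by rewrite /g /= yo eqxx; case: (vfb y).
Qed.

(** Fixing the variable [j] in the composite confines the coordinates outside
    [A] to a box; over each point of the box [f] is bounded along [A], as [A] is
    not wild, and these bounds are bounded on the box. *)
Lemma almost_unary_comp_tame (n : nat) (f : operation X n) (m : nat)
    (g : 'I_n -> operation X m) (F : 'I_n -> X -> X) (j : 'I_m)
    (A : {set 'I_n}) :
  ~ wild f A ->
  (forall i, i \notin A -> forall x, (g i x < F i (x j))%O) ->
  almost_unary (fun x => f (fun i => g i x)).
Proof.
move=> tame gF; have [o _] := inhabited_carrier.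
have bdd a : exists M, forall x : 'I_n -> X,
    (forall i, i \notin A -> x i = a i) -> (f x < M)%O.
  apply: contrapT => unbd; apply/tame/wildP; exists a => y.
  apply: contrapT => noy; apply: unbd; exists y => x xa.
  by rewrite ltNge; apply/negP => yx; apply: noy; exists x.
have [h hf] := choice bdd.
have [G hG] := choice (fun y : X =>
  bounded_on_box h (F^~ y) (enum (~: A)%SET) (fun=> o)).
exists G, j => x.
(* The coordinates in [A] are reset to [o], to obtain a point of the box. *)
pose a i := if i \in A then o else g i x.
apply: (@lt_trans _ _ (h a)).
  by apply: hf => i iA; rewrite /a (negbTE iA).
apply: hG => i; rewrite mem_enum inE /a; first by rewrite negbK => ->.
by move=> iA; rewrite (negbTE iA); exact: gF.
Qed.

(** The indices whose inner function is not controlled by the first variable,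
    and those not controlled by the second one, form disjoint sets, so one of
    the two is not wild. *)
Lemma Pol_of_wild_meet (n : nat) (f : operation X n) :
  (forall A B : {set 'I_n}, wild f A -> wild f B ->
     (A :&: B)%SET != finset.set0) ->
  Pol (T1 X) n f.
Proof.
move=> fAB g gT1.
have [F /choice [k gF]] := choice gT1.
have comp j : ~ wild f [set i | k i != j]%SET ->
    T1 X (fun x => f (fun i => g i x)).
  move=> tame; apply: (almost_unary_comp_tame (F := F) (j := j) tame) => i.
  by rewrite inE negbK => /eqP <-; exact: gF.
have [w0|] := pselect (wild f [set i | k i != ord0]%SET); last exact: comp.
have [w1|] := pselect (wild f [set i | k i != ord_max]%SET); last exact: comp.
have /negP[] := fAB _ _ w0 w1; apply/eqP/setP => i; rewrite !inE.
by case: (k i) => [[|[|]]].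
Qed.

End RegularCardinal.

Theorem theorem28 (d : Order.disp_t) (X : orderType d)
    (hX : infinite_regular_cardinal X) (n : nat) (hn : 0 < n)
    (f : operation X n) :
  Pol (T1 X) n f <->
  (forall A B : {set 'I_n}, wild f A -> wild f B -> (A :&: B)%SET != finset.set0).
Proof.
split; last exact: Pol_of_wild_meet.
by move=> fPol A B; exact: wild_meet_of_Pol.
Qed.
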